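(* Let $p \geqslant 2$ be an integer. Every sentence true in the standard model $(\mathbb N, S, +, 0, V_p)$ is a consequence of $\mathsf{T_{BA}}_p$, i.e. $\mathsf{T_{BA}}_p \vDash \mathsf{BA}_p$; in particular $\mathsf{T_{BA}}_p$ is complete.
   Context: Fix an integer $p \geqslant 2$. The language consists of a constant $0$, a unary function symbol $S$, a binary function symbol $+$ and a unary function symbol $V_p$. In the standard model $(\mathbb N, S, +, 0, V_p)$, $S(n)=n+1$, $+$ is addition, $V_p(0)=0$ and, for $n>0$, $V_p(n)=p^k$ where $p^k \mid n$ and $p^{k+1}\nmid n$. $\mathsf{BA}_p$ denotes the complete first-order theory of this standard model. For $n\in\mathbb N$, $\underline n$ denotes the numeral $S^n(0)$; for a positive integer $n$ and a term $t$, $n t$ denotes the term $(\dots((t+t)+t)\dots)$ with $n$ occurrences of $t$. Iterated exponentials are defined by $2^k_0=k$, $2^k_{m+1}=2^{2^k_m}$. For a formula $\varphi$, $|\varphi|$ is its length (number of symbols). $x \leqslant y$ abbreviates $\exists z\,(x+z=y)$ for a fresh variable $z$, and $\exists x \leqslant t\, \varphi$ abbreviates $\exists x\,(x\leqslant t \wedge \varphi)$. The theory $\mathsf{T_{BA}}_p$ consists of the (universal closures of the) axioms: (S0) $Sx=Sy\to x=y$; (S1) $0\ne Sx$; (S2) $x=0\vee\exists y\,(x=Sy)$; (A0) $x+0=x$; (A1) $x+Sy=S(x+y)$; (V0) $V_p(0)=0$; (V1) $V_p(\underline 1)=\underline 1$; (V2) $V_p(p x)=p V_p(x)$; (V3)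 $\bigwedge_{i=1}^{p-1} V_p(p x+\underline i)=\underline 1$; and, for each formula $\varphi(x)$ with exactly one free variable, (Bound$_\varphi$) $\exists x\,\varphi(x)\to\exists x\leqslant \underline{n_\varphi}\,\varphi(x)$, where $n_\varphi=p^{2^3_{|\varphi|}}$. *)

(* Defs.v *)
From mathcomp Require Import all_boot.

Set Implicit Arguments.
Unset Strict Implicit.
Unset Printing Implicit Defensive.

Inductive term : Type :=
| Var of nat
| Zero
| Succ of term
| Add of term & term
| V of term.

Inductive formula : Type :=
| Eq of term & term
| Not of formula
| And of formula & formula
| Or of formula & formula
| Imp of formula & formula
| All of nat & formula
| Ex of nat & formula.

Fixpoint tfv (t : term) : seq nat :=
  match t with
  | Var x => [:: x]
  | Zero => [::]
  | Succ u | V u => tfv u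
  | Add u v => tfv u ++ tfv v
  end.

Fixpoint fv (f : formula) : seq nat :=
  match f with
  | Eq t u => tfv t ++ tfv u
  | Not g => fv g
  | And g h | Or g h | Imp g h => fv g ++ fv h
  | All x g | Ex x g => [seq y <- fv g | y != x]
  end.

Definition sentence (f : formula) : Prop := fv f = [::].

(* The length counts every occurrence of a symbol; a variable is a single
   symbol, so a quantifier contributes two (itself and its variable).
   Parentheses are punctuation and are not counted: this is the length of the
   formula in prefix notation. *)
Fixpoint tlength (t : term) : nat :=
  match t with
  | Var _ | Zero => 1
  | Succ u | V u => (tlength u).+1
  | Add u v => (tlength u + tlength v).+1
  end.

Fixpoint flength (f : formula) : nat :=
  match f with
  | Eq t u => (tlength t + tlength u).+1
  | Not g => (flength g).+1
  | And g h | Or g h | Imp g h => (flength g + flength h).+1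
  | All _ g | Ex _ g => (flength g).+2
  end.

Record structure : Type := Structure {
  carrier :> Type;
  zero : carrier;
  succ : carrier -> carrier;
  add : carrier -> carrier -> carrier;
  valp : carrier -> carrier }.

Fixpoint eval (M : structure) (e : nat -> M) (t : term) : M :=
  match t with
  | Var x => e x
  | Zero => zero M
  | Succ u => succ (eval e u)
  | Add u v => add (eval e u) (eval e v)
  | V u => valp (eval e u)
  end.

Definition update (T : Type) (e : nat -> T) (x : nat) (a : T) : nat -> T :=
  fun y => if y == x then a else e y.

Fixpoint sat (M : structure) (e : nat -> M) (f : formula) : Prop :=
  match f with
  | Eq t u => eval e t = eval e u
  | Not g => ~ sat e g
  | And g h => sat e g /\ sat e h
  | Or g h => sat e g \/ sat e h
  | Imp g h => sat e g -> sat e h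
  | All x g => forall a : M, sat (update e x a) g
  | Ex x g => exists a : M, sat (update e x a) g
  end.

Definition models (M : structure) (f : formula) : Prop :=
  forall e : nat -> M, sat e f.

Definition theory : Type := formula -> Prop.

Definition entails (T : theory) (f : formula) : Prop :=
  forall M : structure, (forall g, T g -> models M g) -> models M f.

Definition entails_theory (T U : theory) : Prop :=
  forall f, U f -> entails T f.

Definition complete (T : theory) : Prop :=
  forall f, sentence f -> entails T f \/ entails T (Not f).

(* [logn] is not suitable here, since p need not be prime. For 1 < p and 0 < n,
   p ^ k %| n forces k < n, so the maximum is over all k such that p ^ k
   divides n (see [Vp_spec]). *)
Definition Vp (p n : nat) : nat :=
  if n == 0 then 0 else p ^ (\max_(k < n | p ^ k %| n) k).

Lemma Vp_spec (p n : nat) : 1 < p -> 0 < n ->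
  exists k, [/\ Vp p n = p ^ k, p ^ k %| n & ~~ (p ^ k.+1 %| n)].
Proof.
move=> p_gt1 n_gt0; rewrite /Vp eqn0Ngt n_gt0 /=.
set m := \max_(k < n | _) k; exists m; split=> //.
  rewrite /m; have [|i Pi ->] := @eq_bigmax_cond _ [pred k : 'I_n | p ^ k %| n] val.
    by apply/card_gt0P; exists (Ordinal n_gt0); rewrite inE /= expn0 dvd1n.
  exact: Pi.
apply/negP=> dv; have lt_mn : m.+1 < n.
  exact: leq_trans (ltn_expl _ p_gt1) (dvdn_leq n_gt0 dv).
have := @leq_bigmax_cond _ [pred k : 'I_n | p ^ k %| n] val (Ordinal lt_mn) dv.
by rewrite -[X in _ <= X]/m /= ltnn.
Qed.

Definition std_model (p : nat) : structure :=
  @Structure nat 0 S addn (Vp p).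

Definition BA (p : nat) : theory :=
  fun f => sentence f /\ models (std_model p) f.

Definition numeral (n : nat) : term := iter n Succ Zero.

(* (...((t + t) + t)...) with n occurrences of t, for 0 < n. *)
Definition nmul (n : nat) (t : term) : term := iter n.-1 (Add^~ t) t.

Definition fresh (t u : term) : nat := (\max_(y <- tfv t ++ tfv u) y).+1.

Definition le_formula (t u : term) : formula :=
  let z := fresh t u in Ex z (Eq (Add t (Var z)) u).

Definition bounded_ex (x : nat) (t : term) (f : formula) : formula :=
  Ex x (And (le_formula (Var x) t) f).

Definition tower (k m : nat) : nat := iter m (expn 2) k.

Definition bound (p : nat) (f : formula) : nat := p ^ tower 3 (flength f).

Local Notation x := (Var 0).
Local Notation y := (Var 1).

Inductive TBA (p : nat) : theory :=
| S0 : TBA p (All 0 (All 1 (Imp (Eq (Succ x) (Succ y)) (Eq x y))))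
| S1 : TBA p (All 0 (Not (Eq Zero (Succ x))))
| S2 : TBA p (All 0 (Or (Eq x Zero) (Ex 1 (Eq x (Succ y)))))
| A0 : TBA p (All 0 (Eq (Add x Zero) x))
| A1 : TBA p (All 0 (All 1 (Eq (Add x (Succ y)) (Succ (Add x y)))))
| V0 : TBA p (Eq (V Zero) Zero)
| V1 : TBA p (Eq (V (numeral 1)) (numeral 1))
| V2 : TBA p (All 0 (Eq (V (nmul p x)) (nmul p (V x))))
(* The conjunction of C 1, ..., C p.-1, nonempty for 1 < p. *)
| V3 : let C i := Eq (V (Add (nmul p x) (numeral i))) (numeral 1) in
       TBA p (All 0 (foldl And (C 1) [seq C i | i <- iota 2 p.-2]))
| Bound : forall (v : nat) (f : formula), fv f =i [:: v] ->
       TBA p (Imp (Ex v f) (bounded_ex v (numeral (bound p f)) f)).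

(* Main.v *)
(* In a model M of the theory, (Bound) together with the fact that everything
   below a numeral is a numeral says that a nonempty set definable from numerals
   contains a numeral.  By the Tarski-Vaught test the numerals form an elementary
   substructure of M, and the remaining axioms make it isomorphic to the
   standard model. *)
Require Import Defs.
From mathcomp Require Import all_boot.
From Stdlib Require Import Classical.

Set Implicit Arguments.
Unset Strict Implicit.
Unset Printing Implicit Defensive.

(** If [p ^ j] divides [n], so do all lower powers of [p]; hence the exponents that divide form an
    initial segment, and it has only one last member. *)
Lemma Vp_eq (p n k : nat) : 1 < p -> 0 < n ->
  p ^ k %| n -> ~~ (p ^ k.+1 %| n) -> Vp p n = p ^ k.
Proof.
move=> p_gt1 n_gt0 dvk ndvk; have [j [-> dvj ndvj]] := Vp_spec p_gt1 n_gt0.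
have [lt_jk|lt_kj|-> //] := ltngtP j k.
  by case/negP: ndvj; apply: dvdn_trans dvk; apply: dvdn_exp2l.
by case/negP: ndvk; apply: dvdn_trans dvj; apply: dvdn_exp2l.
Qed.

Lemma Vp_mull (p n : nat) : 1 < p -> Vp p (p * n) = p * Vp p n.
Proof.
move=> p_gt1; have p_gt0 := ltnW p_gt1.
have [->|n_gt0] := posnP n; first by rewrite /Vp !muln0.
have [k [-> dvk ndvk]] := Vp_spec p_gt1 n_gt0.
by rewrite -expnS; apply: Vp_eq; rewrite ?muln_gt0 ?p_gt0 // expnS dvdn_pmul2l.
Qed.

Lemma Vp_ndvd (p n : nat) : 1 < p -> ~~ (p %| n) -> Vp p n = 1.
Proof.
move=> p_gt1 ndv; have n_gt0: 0 < n by case: n ndv => //; rewrite dvdn0.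
by rewrite (@Vp_eq p n 0).
Qed.

Lemma eval_eq_in (M : structure) (e e' : nat -> M) (t : term) :
  {in tfv t, e =1 e'} -> eval e t = eval e' t.
Proof.
elim: t => [z|//|t IH|t IHt u IHu|t IH] /= ee'.
- by apply: ee'; rewrite inE.
- by rewrite IH.
- by rewrite IHt ?IHu // => z zt; apply: ee'; rewrite mem_cat zt ?orbT.
- by rewrite IH.
Qed.

Lemma update_eq_in (T : Type) (e e' : nat -> T) (z : nat) (a : T) (s : seq nat) :
  {in [seq y <- s | y != z], e =1 e'} -> {in s, update e z a =1 update e' z a}.
Proof.
move=> ee' y ys; rewrite /update; case: ifPn => // yz.
by apply: ee'; rewrite mem_filter yz.
Qed.

Lemma sat_eq_in (M : structure) (e e' : nat -> M) (f : formula) :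
  {in fv f, e =1 e'} -> (sat e f <-> sat e' f).
Proof.
elim: f e e' => [t u|g IHg|g IHg h IHh|g IHg h IHh|g IHg h IHh|z g IHg|z g IHg]
  e e' /= ee'.
- by rewrite (@eval_eq_in _ e e' t) ?(@eval_eq_in _ e e' u) // => z zt;
    apply: ee'; rewrite mem_cat zt ?orbT.
- by rewrite (IHg e e').
1-3: by rewrite (IHg e e') ?(IHh e e') // => z zt; apply: ee';
       rewrite mem_cat zt ?orbT.
- by split=> H a; apply/(IHg _ _ (update_eq_in a ee')).
- by split=> -[a H]; exists a; apply/(IHg _ _ (update_eq_in a ee')).
Qed.

Lemma sat_eq (M : structure) (e e' : nat -> M) (f : formula) :
  e =1 e' -> (sat e f <-> sat e' f).
Proof. by move=> ee'; apply: sat_eq_in => z _; apply: ee'. Qed.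

Lemma sentence_models (M : structure) (e : nat -> M) (f : formula) :
  sentence f -> sat e f -> models M f.
Proof. by move=> fv0 H e'; apply: (sat_eq_in _).1 H; rewrite fv0. Qed.

Definition num (M : structure) (n : nat) : M := iter n (@succ M) (zero M).

Lemma eval_numeral (M : structure) (e : nat -> M) (n : nat) :
  eval e (numeral n) = num M n.
Proof. by elim: n => //= n ->. Qed.

Lemma tfv_numeral (n : nat) : tfv (numeral n) = [::].
Proof. by elim: n. Qed.

Lemma sat_foldl_And (M : structure) (e : nat -> M) (C : nat -> formula)
    (s : seq nat) (f : formula) :
  sat e (foldl And f [seq C i | i <- s]) ->
  sat e f /\ {in s, forall i, sat e (C i)}.
Proof.
elim: s f => //= i s IH f /IH[[sf si] ss]; split=> // j.
by rewrite inE => /orP[/eqP-> | /ss].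
Qed.

(** This plays the role of substituting numerals for the variables in [s]. Guarded quantifiers
    replace the substitution, so capture of variables is never an issue. *)
Definition pin (c : nat -> nat) (s : seq nat) (f : formula) : formula :=
  foldr (fun y g => Ex y (And (Eq (Var y) (numeral (c y))) g)) f s.

Lemma fv_pin (c : nat -> nat) (s : seq nat) (f : formula) (z : nat) :
  (z \in fv (pin c s f)) = (z \notin s) && (z \in fv f).
Proof.
elim: s => //= y s IH; rewrite tfv_numeral eqxx /= mem_filter IH inE negb_or.
by rewrite andbA.
Qed.

Lemma sat_pin (M : structure) (e : nat -> M) (c : nat -> nat) (s : seq nat)
    (f : formula) :
  sat e (pin c s f) <-> sat (fun z => if z \in s then num M (c z) else e z) f.
Proof.
elim: s e => [|y s IH] e //=.
(* [y] may occur again in [s], but both pins give it the same value [num M (c y)]. *)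
have upd_pin: (fun z => if z \in s then num M (c z)
               else update e y (num M (c y)) z) =1
       (fun z => if z \in y :: s then num M (c z) else e z).
  by move=> z; rewrite /update inE; case: eqP => [->|_] //=; case: ifP.
split=> [[a []]|H].
  rewrite eval_numeral /update eqxx => -> /IH; exact: (sat_eq _ upd_pin).1.
exists (num M (c y)); rewrite eval_numeral; split; first by rewrite /update eqxx.
by apply/IH; apply/(sat_eq _ upd_pin).
Qed.

Lemma fresh_gt (t u : term) (z : nat) : z \in tfv t ++ tfv u -> z < fresh t u.
Proof. by move=> zin; rewrite ltnS (leq_bigmax_seq (F := id)). Qed.

Lemma num_add (p : nat) (M : structure) (m n : nat) :
  (forall g, TBA p g -> models M g) -> add (num M m) (num M n) = num M (m + n).
Proof.
move=> HM; have e : nat -> M := fun=> zero M.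
elim: n => [|n IH]; first by rewrite addn0; apply: (HM _ (A0 p) e (num M m)).
by rewrite addnS /= -IH; apply: (HM _ (A1 p) e (num M m) (num M n)).
Qed.

Lemma num_nmul (p : nat) (M : structure) (e : nat -> M) (t : term) (k m : nat) :
  (forall g, TBA p g -> models M g) -> 0 < k -> eval e t = num M m ->
  eval e (nmul k t) = num M (k * m).
Proof.
move=> HM; case: k => // k _ tm; rewrite /nmul /=.
elim: k => [|k IH] /=; first by rewrite mul1n.
by rewrite IH tm (num_add _ _ HM) -mulSnr.
Qed.

(** Strong induction on [n], looking at its last digit in base [p]: if it is zero, (V2) reduces [n]
    to the smaller number [n %/ p]; otherwise (V3) gives the value 1. *)
Lemma num_valp (p : nat) (M : structure) (n : nat) : 1 < p ->
  (forall g, TBA p g -> models M g) -> valp (num M n) = num M (Vp p n).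
Proof.
move=> p_gt1 HM; have p_gt0 := ltnW p_gt1; pose e : nat -> M := fun=> zero M.
have [m] := ubnP n; elim: m n => // m IH n /ltnSE le_nm.
have [->|n_gt0] := posnP n; first exact: (HM _ (V0 p) e).
pose q := n %/ p; have nE := divn_eq n p; rewrite -/q mulnC in nE.
pose e_q := update e 0 (num M q).
have eval_pq: eval e_q (nmul p (Var 0)) = num M (p * q) by apply: (num_nmul HM).
have [r0|r_gt0] := posnP (n %% p).
  rewrite r0 addn0 in nE; rewrite nE Vp_mull // -eval_pq.
  have /= -> := HM _ (V2 p) e (num M q).
  apply: (num_nmul HM) => //=; apply: IH.
  by rewrite (leq_trans _ le_nm) // ltn_Pdiv.
rewrite Vp_ndvd /dvdn -?lt0n //.
have lt_rp: n %% p < p by rewrite ltn_mod.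
have /sat_foldl_And[C1 Cs] := HM _ (V3 p) e (num M q).
(* The conjunct for remainder 1 is the head of the fold; the others come from the list, which runs
   from 2 to [p.-1]. *)
have: sat e_q (Eq (V (Add (nmul p (Var 0)) (numeral (n %% p)))) (numeral 1)).
  have [-> //|r_neq1] := eqVneq (n %% p) 1.
  apply: (Cs (n %% p)); rewrite mem_iota ltn_neqAle eq_sym r_neq1 r_gt0 /=.
  by rewrite -subn2 subnKC.
by rewrite /= eval_pq eval_numeral (num_add _ _ HM) -nE.
Qed.

Lemma num_inj (p : nat) (M : structure) :
  (forall g, TBA p g -> models M g) -> injective (num M).
Proof.
move=> HM; have e : nat -> M := fun=> zero M.
have num0 n : num M 0 <> num M n.+1 by apply: (HM _ (S1 p) e (num M n)).
elim=> [|m IH] [|n] // eq_mn; first by case: (num0 n).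
  by case: (num0 m).
by congr _.+1; apply: IH; apply: (HM _ (S0 p) e (num M m) (num M n)).
Qed.

(** This makes the numerals an initial segment of [M]. By (S2), [b] is zero, and then [a] is the
    numeral of [n], or a successor. In the latter case (A1) moves the successor outside the sum,
    where (S1) refutes it for zero and (S0) cancels it otherwise. *)
Lemma num_add_inv (p : nat) (M : structure) (n : nat) (a b : M) :
  (forall g, TBA p g -> models M g) -> add a b = num M n ->
  exists m, a = num M m.
Proof.
move=> HM; have e : nat -> M := fun=> zero M.
elim: n b => [|n IH] b.
all: have [b0|[c bS]] : b = zero M \/ exists c, b = succ c
       by apply: (HM _ (S2 p) e b).
all: have add0 : add a (zero M) = a by apply: (HM _ (A0 p) e a).
1,3: by rewrite b0 add0 => ->; eexists.
all: have addS : add a (succ c) = succ (add a c) by apply: (HM _ (A1 p) e a c).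
all: rewrite bS addS => acn.
  by have []: zero M <> succ (add a c) by apply: (HM _ (S1 p) e (add a c)).
by apply: (IH c); apply: (HM _ (S0 p) e (add a c) (num M n)).
Qed.

(** The Tarski-Vaught criterion for the numerals. Pinning every free variable other than [v] leaves
    a formula to which (Bound) applies; the witness it yields lies below a numeral, so it is one. *)
Lemma num_witness (p : nat) (M : structure) (c : nat -> nat) (v : nat)
    (f : formula) (a : M) :
  (forall g, TBA p g -> models M g) ->
  sat (update (fun z => num M (c z)) v a) f ->
  exists n, sat (update (fun z => num M (c z)) v (num M n)) f.
Proof.
move=> HM fa; pose e z := num M (c z).
(* The trivial conjunct makes v occur free, as (Bound) requires. *)
pose f' := And f (Eq (Var v) (Var v)).
pose s := [seq z <- fv f | z != v]; pose g := pin c s f'.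
have fv_g: fv g =i [:: v].
  move=> z; rewrite fv_pin mem_filter /= mem_cat !inE orbb.
  by case: eqP => [->|_] /=; rewrite ?orbT // orbF andNb.
(* Pinning does not alter the assignment: [v] is not in [s], and on [s] the pinned values are those
   of [e]. *)
have sat_g b : sat (update e v b) g <-> sat (update e v b) f.
  rewrite sat_pin /= (@sat_eq _ _ (update e v b)); first by split=> [[]|].
  by move=> z; case: ifP => //; rewrite mem_filter /update => /andP[/negPf->].
have [b [[d bd] gb]] := HM _ (Bound p fv_g) e (ex_intro _ a ((sat_g a).2 fa)).
have [n bn] : exists n, b = num M n.
  move: bd; set z := fresh _ _; rewrite /= eval_numeral.
  (* The variable bound in the abbreviation of the order differs from [v], so assigning [d] to it
     leaves the value [b] of [v] intact. *)
  have /negPf vz: v != z by rewrite neq_ltn [v < z]fresh_gt ?mem_head.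
  by rewrite /update vz !eqxx; apply: num_add_inv HM.
by exists n; rewrite -bn; apply/sat_g.
Qed.

Lemma num_eval (p : nat) (M : structure) (c : nat -> std_model p) (t : term) :
  1 < p -> (forall g, TBA p g -> models M g) ->
  eval (fun z => num M (c z)) t = num M (eval c t).
Proof.
move=> p_gt1 HM; elim: t => [//|//|t /= -> //|t IHt u IHu|t IHt] /=.
  by rewrite IHt IHu (num_add _ _ HM).
by rewrite IHt (num_valp _ p_gt1 HM).
Qed.

Lemma num_elementary (p : nat) (M : structure) (c : nat -> std_model p)
    (f : formula) :
  1 < p -> (forall g, TBA p g -> models M g) ->
  sat c f <-> sat (fun z => num M (c z)) f.
Proof.
move=> p_gt1 HM.
have num_update d z n : (fun y => num M (update d z n y)) =1
    update (fun y => num M (d y)) z (num M n).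
  by move=> y; rewrite /update; case: ifP.
elim: f c => [t u|g IHg|g IHg h IHh|g IHg h IHh|g IHg h IHh|z g IHg|z g IHg]
  c /=.
- by rewrite !num_eval //; split=> [->|/(num_inj HM)].
- by rewrite IHg.
1-3: by rewrite IHg IHh.
- split=> [H a|H n]; last first.
    by apply/IHg; apply/(sat_eq _ (num_update _ _ _)).
  (* A counterexample in [M] is a witness for [Not g], hence there is one among the numerals,
     against the truth of [g] at every natural number. *)
  apply: NNPP => nga.
  have [n] := @num_witness p M c z (Not g) a HM nga.
  by apply; apply/(sat_eq _ (num_update _ _ _)); apply/IHg.
- split=> [[n gn]|[a ga]].
    by exists (num M n); apply/(sat_eq _ (num_update _ _ _)); apply/IHg.
  have [n gn] := num_witness HM ga.
  by exists n; apply/IHg; apply/(sat_eq _ (num_update _ _ _)).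
Qed.

Theorem theorem5 (p : nat) (hp : 1 < p) :
  entails_theory (TBA p) (BA p) /\ complete (TBA p).
Proof.
have TBA_BA: entails_theory (TBA p) (BA p).
  move=> f [fv0 stdf] M HM; pose c : nat -> std_model p := fun=> 0.
  by apply: sentence_models fv0 _; apply/(@num_elementary p M c).
split=> // f fv0; pose c : nat -> std_model p := fun=> 0.
(* Whichever of [f] and [Not f] is true in the standard model belongs to [BA p]. *)
have [cf|ncf] := classic (sat c f); [left | right]; apply: TBA_BA.
  by split; last exact: sentence_models cf.
by split; last exact: (@sentence_models _ c (Not f)).
Qed.
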